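(* Let $3\leq m\leq n$, $\ell=m-1$, $p=(m-1)n$. Then $\overline{\mathfrak{S}}=\overline{\mathfrak{M}}=\overline{\mathfrak{C}}$ in $\mathbb{R}^{n\times n\times\ell}$ (Euclidean closures).
   Context: For $Y=(Y_1;\ldots;Y_\ell)\in\mathbb{R}^{n\times n\times\ell}$ and $\mathbf{a}=(a_1,\ldots,a_\ell,a_m)^\top\in\mathbb{R}^m$, $M(\mathbf{a},Y)=\sum_{k=1}^\ell a_kY_k-a_mE_n$. $\mathfrak{C}=\{Y\mid\det M(\mathbf a,Y)<0\text{ for some }\mathbf a\}$. $V(Y)=\{\mathbf{a}\in\mathbb{R}^n\mid \sum_{k=1}^\ell x_kY_k\mathbf{a}=x_m\mathbf{a}\text{ for some }(x_1,\ldots,x_m)^\top\neq\mathbf{0}\}$, $\hat V(Y)$ its linear span, $\mathfrak{S}=\{Y\mid\dim\hat V(Y)=n\}$. $\mathfrak{M}$ is the set of $Y$ for which there exist a real $m\times p$ matrix $(x_{ij})$ and a real $n\times p$ matrix $A=(\mathbf{a}_1,\ldots,\mathbf{a}_p)$ with $(x_{1j}Y_1+\cdots+x_{\ell j}Y_\ell-x_{mj}E_n)\mathbf{a}_j=\mathbf{0}$ for all $j$ and $\begin{pmatrix}AD_1\\ \vdots\\ AD_\ell\end{pmatrix}$ nonsingular, where $D_k=\operatorname{diag}(x_{k1},\ldots,x_{kp})$. *)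

(* Defs.v *)
From HB Require Import structures.
From mathcomp Require Import all_boot all_order all_algebra.
Set Implicit Arguments. Unset Strict Implicit. Unset Printing Implicit Defensive.
Import Order.TTheory GRing.Theory Num.Theory.
Local Open Scope ring_scope.

Section Defs.
Variable R : rcfType.

Definition tensor (n l : nat) := 'I_l -> 'M[R]_n.

Definition Mmat (n l : nat) (a : 'I_l -> R) (am : R) (Y : tensor n l) : 'M[R]_n :=
  \sum_(k < l) a k *: Y k - am%:M.

Definition frakC (n l : nat) (Y : tensor n l) : Prop :=
  exists (a : 'I_l -> R) (am : R), \det (Mmat a am Y) < 0.

Definition Vset (n l : nat) (Y : tensor n l) (v : 'cV[R]_n) : Prop :=
  exists (x : 'I_l -> R) (xm : R),
    ((exists k, x k != 0) \/ xm != 0) /\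
    (\sum_(k < l) x k *: Y k) *m v = xm *: v.

Definition span_dim (n : nat) (S : 'cV[R]_n -> Prop) (d : nat) : Prop :=
  (exists (r : nat) (B : 'M[R]_(n, r)), (forall j, S (col j B)) /\ \rank B = d) /\
  (forall (r : nat) (B : 'M[R]_(n, r)), (forall j, S (col j B)) -> (\rank B <= d)%N).

Definition frakS (n l : nat) (Y : tensor n l) : Prop := span_dim (Vset Y) n.

Lemma sum_const_nat (l n : nat) : (\sum_(i < l) n)%N = (l * n)%N.
Proof. by rewrite big_const_ord iter_addn_0 mulnC. Qed.

Definition blockAD (n l p : nat) (x : 'I_l -> 'I_p -> R) (A : 'M[R]_(n, p))
  : 'M[R]_(l * n, p) :=
  castmx (sum_const_nat l n, erefl p)
    (@mxcol R l (fun _ => n) p (fun k => A *m diag_mx (\row_j x k j))).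

(* frak M, with p = (m-1) n = l n; x = (x_ij) is m x p, split as its first
   l rows x and its last row xm.  Since p = l n the block matrix is square and
   "nonsingular" means invertible. *)
Definition frakM (n l : nat) (Y : tensor n l) : Prop :=
  exists (x : 'I_l -> 'I_(l * n)%N -> R) (xm : 'I_(l * n)%N -> R) (A : 'M[R]_(n, (l * n)%N)),
    (forall j : 'I_(l * n)%N, (\sum_(k < l) x k j *: Y k - (xm j)%:M) *m col j A = 0) /\
    (blockAD x A \in unitmx).

(* Euclidean closure in R^{n x n x l} (max-norm balls give the same topology). *)
Definition eclosure (n l : nat) (S : tensor n l -> Prop) (Y : tensor n l) : Prop :=
  forall eps : R, 0 < eps -> exists Z : tensor n l, S Z /\
    forall (k : 'I_l) (i j : 'I_n), `|Y k i j - Z k i j| < eps.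

End Defs.

(* Main.v *)
Require Import Defs.
From HB Require Import structures.
From mathcomp Require Import all_boot all_order all_algebra.
From mathcomp Require Import ring lra.
Import Order.TTheory GRing.Theory Num.Theory.
Local Open Scope ring_scope.
Set Implicit Arguments. Unset Strict Implicit. Unset Printing Implicit Defensive.

(* M is contained in S, and S in the closure of C because a singular matrix is a limit of matrices
   of negative determinant. It remains to approximate a tensor Y of C by tensors of M. After a
   change of bases and a small perturbation, Y_1 is the companion matrix of a monic p having a
   simple real root r. Put q(z) = p(z + r). Along the curve x(z) = (1, q, q^2, ..., q^(l-1)) the
   eigenvalue r of Y(x(0)) = Y_1 continues to a formal eigenvalue t(z) (Hensel), with eigenvector
   a(z). If the first L = l n Taylor coefficients of x(z) (x) a(z) are linearly independent, then
   L nearby parameters z_j = e j and a correction of Y that is O(e) make the x(z_j) (x) a(z_j) exact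
   and independent, so Y is a limit of elements of M. Independence is a polynomial condition on
   Y_2, ..., Y_l; moving them along a line to the model Y_2 = E_(n,1), Y_3 = ... = 0 shows that it
   holds arbitrarily close to Y: for the model t = z + r and a = (1, t, ..., t^(n-1)) exactly, and
   the entries q^k t^i of x (x) a have distinct degrees below L. *)

(** * Smallness and closures *)

Section Near0.
Variable R : rcfType.

(** One-sided germs at 0: they suffice for closures and keep the parameter nonzero. *)
Definition near0 (P : R -> Prop) :=
  exists2 d : R, 0 < d & forall x, 0 < x < d -> P x.

Lemma near0_imp (P Q : R -> Prop) : (forall x, P x -> Q x) -> near0 P -> near0 Q.
Proof. by move=> PQ [d d0 H]; exists d => // x /H /PQ. Qed.

Lemma near0_and (P Q : R -> Prop) :
  near0 P -> near0 Q -> near0 (fun x => P x /\ Q x).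
Proof.
move=> [d d0 Pd] [e e0 Qe]; exists (Num.min d e); first by rewrite lt_min d0.
by move=> x /andP[x0]; rewrite lt_min => /andP[xd xe]; split; [apply: Pd | apply: Qe]; rewrite x0.
Qed.

Lemma near0_forall (I : finType) (P : I -> R -> Prop) :
  (forall i, near0 (P i)) -> near0 (fun x => forall i, P i x).
Proof.
move=> nP.
have: forall s : seq I, near0 (fun x => forall i, i \in s -> P i x).
  elim=> [|i s IH]; first by exists 1.
  apply: near0_imp (near0_and (nP i) IH) => x [Pi Ps] j.
  by rewrite inE => /predU1P[-> //|/Ps].
by move=> /(_ (enum I)); apply: near0_imp => x H i; apply: H; rewrite mem_enum.
Qed.

Lemma near0_ex (P : R -> Prop) : near0 P -> exists x, P x.
Proof.
move=> [d d0 H]; exists (d / 2%:R); apply: H.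
by rewrite divr_gt0 //= ltr_pdivrMr // mulr_natr mulr2n ltrDl.
Qed.

Lemma near0_pos : near0 (fun x => 0 < x).
Proof. by exists 1 => // x /andP[]. Qed.

(** For a polynomial [p * 'X + c] with [c > 0], a bound [K] of [p] on the interval from 0 to 1 keeps
    the value positive while [x < c / K]. *)
Lemma near0_horner_gt0 (p : {poly R}) : 0 < p.[0] -> near0 (fun x => 0 < p.[x]).
Proof.
elim/poly_ind: p => [|p c _]; first by rewrite horner0 ltxx.
rewrite hornerMXaddC mulr0 add0r => c0.
have [M HM] := poly_itv_bound p 0 1.
pose K := Num.max M 1.
have K0 : 0 < K by rewrite lt_max ltr01 orbT.
exists (Num.min 1 (c / K)); first by rewrite lt_min ltr01 divr_gt0.
move=> x /andP[x0]; rewrite lt_min ltr_pdivlMr // => /andP[x1 xK].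
rewrite hornerMXaddC.
have: `|p.[x]| <= K by rewrite le_max HM ?(ltW x0) ?(ltW x1).
rewrite ler_norml => /andP[pK _].
have: - K * x <= p.[x] * x by rewrite ler_wpM2r // ltW.
by lra.
Qed.

(** Dividing by the largest power of ['X] leaves a cofactor that is nonzero at 0; its square is
    positive near 0. *)
Lemma near0_horner_neq0 (p : {poly R}) : p != 0 -> near0 (fun x => p.[x] != 0).
Proof.
move=> p0; have [[|k] [q]] := multiplicity_XsubC p 0; rewrite p0 /=.
  move=> q0 ->; have: 0 < (q ^+ 2).[0].
    by rewrite horner_exp exprn_even_gt0 //=; apply: q0.
  move=> /near0_horner_gt0; apply: near0_imp => x.
  by rewrite expr0 mulr1 horner_exp exprn_even_gt0.
move=> q0 ->; have: 0 < (q ^+ 2).[0].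
  by rewrite horner_exp exprn_even_gt0 //=; apply: q0.
move=> /near0_horner_gt0 /near0_and /(_ near0_pos); apply: near0_imp => x [].
rewrite horner_exp exprn_even_gt0 //= => qx x0.
by rewrite hornerM mulf_neq0 // subr0 horner_exp hornerX expf_neq0 // gt_eqF.
Qed.

(** Squaring turns the bound into positivity of the polynomial [e^2 d^2 - p^2], which holds at 0. *)
Lemma near0_frac_lt (p d : {poly R}) (e : R) :
  p.[0] = 0 -> d.[0] != 0 -> 0 < e -> near0 (fun x => `|p.[x] / d.[x]| < e).
Proof.
move=> p0 d0 e0.
have: 0 < ((e ^+ 2) *: d ^+ 2 - p ^+ 2).[0].
  rewrite hornerD hornerN hornerZ !horner_exp p0 expr0n subr0.
  by rewrite mulr_gt0 // exprn_even_gt0 //= ?gt_eqF.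
move=> /near0_horner_gt0; apply: near0_imp => x.
rewrite hornerD hornerN hornerZ !horner_exp subr_gt0 -exprMn => H.
have dx : d.[x] != 0.
  by apply: contraTneq H => ->; rewrite mulr0 expr0n -leNgt sqr_ge0.
rewrite normrM normfV ltr_pdivrMr ?normr_gt0 //.
rewrite -(ltr_pXn2r (n := 2)) ?nnegrE ?mulr_ge0 ?normr_ge0 ?(ltW e0) //.
by rewrite exprMn !real_normK ?num_real // -exprMn.
Qed.

Lemma near0_horner_lt (p : {poly R}) (e : R) :
  p.[0] = 0 -> 0 < e -> near0 (fun x => `|p.[x]| < e).
Proof.
move=> p0 e0; have := near0_frac_lt (d := 1) p0 _ e0.
rewrite hornerC oner_eq0 => /(_ isT); apply: near0_imp => x.
by rewrite hornerC divr1.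
Qed.

End Near0.

Section Closure.
Variables (R : rcfType) (n l : nat).
Implicit Types (S T : tensor R n l -> Prop) (Y Z : tensor R n l).

Lemma eclosure_sub S T Y : (forall Z, S Z -> eclosure T Z) -> eclosure S Y -> eclosure T Y.
Proof.
move=> ST SY e e0; have e2 : 0 < e / 2%:R by rewrite divr_gt0.
have [Z [/ST TZ YZ]] := SY _ e2; have [W [TW ZW]] := TZ _ e2.
exists W; split=> // k i j; rewrite -(subrKA (Z k i j)) (le_lt_trans (ler_normD _ _)) //.
by rewrite [e]splitr ltrD.
Qed.

Lemma eclosure_mem S Y : S Y -> eclosure S Y.
Proof. by move=> SY e e0; exists Y; split=> // k i j; rewrite subrr normr0. Qed.

(** Closure is idempotent, so approximants in the closure are good enough; this lets successive
    perturbations be chained. *)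
Lemma eclosure_near0 S Y (Z : R -> tensor R n l) :
  near0 (fun x => eclosure S (Z x)) ->
  (forall e, 0 < e -> near0 (fun x => forall k i j, `|Y k i j - Z x k i j| < e)) ->
  eclosure S Y.
Proof.
move=> SZ YZ; apply: (@eclosure_sub (eclosure S)) => // e e0.
by have [x [Sx Yx]] := near0_ex (near0_and SZ (YZ e e0)); exists (Z x).
Qed.

Lemma near0_line Y Z e :
  0 < e -> near0 (fun x => forall k i j, `|Y k i j - (Y k + x *: Z k) i j| < e).
Proof.
move=> e0; apply: near0_forall => k; apply: near0_forall => i; apply: near0_forall => j.
have := @near0_horner_lt R (Z k i j *: 'X) e.
rewrite hornerZ hornerX mulr0 => /(_ erefl e0); apply: near0_imp => x.
by rewrite !mxE opprD addNKr normrN hornerZ hornerX mulrC.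
Qed.

Lemma eclosure_line S Y Z :
  near0 (fun x => eclosure S (fun k => Y k + x *: Z k)) -> eclosure S Y.
Proof. by move=> SZ; apply: eclosure_near0 SZ _ => e; apply: near0_line. Qed.

Lemma eclosure_lipschitz S T (F : tensor R n l -> tensor R n l) (K : R) Y :
  0 <= K ->
  (forall Z Z' d, (forall k i j, `|Z k i j - Z' k i j| <= d) ->
     forall k i j, `|F Z k i j - F Z' k i j| <= K * d) ->
  (forall Z, S Z -> T (F Z)) -> eclosure S Y -> eclosure T (F Y).
Proof.
move=> K0 lipF ST SY e e0; have K1 : 0 < K + 1 by rewrite ltr_wpDl.
(* [K] may be 0, hence the division by [K + 1]. *)
have [Z [SZ YZ]] := SY (e / (K + 1)) (divr_gt0 e0 K1).
exists (F Z); split; first exact: ST.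
move=> k i j; apply: (le_lt_trans (lipF Y Z (e / (K + 1)) _ k i j)) => [k' i' j'|].
  exact: ltW.
by rewrite mulrCA gtr_pMr // ltr_pdivrMr // mul1r ltrDl.
Qed.

End Closure.

(** * The nonsingularity condition *)

Lemma row_freeP_inj (R : fieldType) (m p : nat) (B : 'M[R]_(m, p)) :
  row_free B <-> (forall w : 'rV_m, w *m B = 0 -> w = 0).
Proof.
split=> [fB w wB0 | inj].
  by apply: (row_free_inj fB); rewrite wB0 mul0mx.
rewrite -kermx_eq0; apply/eqP/row_matrixP => i; rewrite row0.
by apply: inj; apply/sub_kermxP/row_sub.
Qed.

Lemma mulmx_castmx_rows (R : fieldType) (a b p : nat) (e : a = b) (M : 'M[R]_(a, p)) (w : 'rV_b) :
  w *m castmx (e, erefl p) M = castmx (erefl, esym e) w *m M.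
Proof. by case: _ / e w => w; rewrite !castmx_id. Qed.

Lemma sum_mxvec (R : pzRingType) (l n p : nat) (W : 'M[R]_(l, n)) (B : 'M[R]_(p, l * n)) j :
  (mxvec W *m B^T) 0 j = \sum_k \sum_i W k i * B j (mxvec_index k i).
Proof.
rewrite mxE pair_bigA /= (reindex _ (curry_mxvec_bij l n)) /=.
by apply: eq_bigr => -[k i] _ /=; rewrite mxvecE mxE.
Qed.

Lemma mxvec_unitP (R : fieldType) (l n : nat) (B : 'M[R]_(l * n)) :
  B^T \in unitmx <->
  (forall W : 'M_(l, n), (forall j, \sum_k \sum_i W k i * B j (mxvec_index k i) = 0) -> W = 0).
Proof.
rewrite -row_free_unit; split=> [/row_freeP_inj inj W W0 | inj].
  apply/(can_inj mxvecK); rewrite linear0; apply: inj; apply/rowP => j.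
  by rewrite sum_mxvec W0 mxE.
apply/row_freeP_inj => w wB; rewrite -[w]vec_mxK (inj (vec_mx w)) ?linear0 // => j.
by rewrite -sum_mxvec vec_mxK wB mxE.
Qed.

Section FrakM.
Variables (R : rcfType) (n l : nat).

(** The rows of the block matrix are indexed by pairs [(k, i)], so a left kernel vector is a matrix
    [W]; later arguments then avoid the cast in [blockAD]. *)
Lemma blockAD_unitP (x : 'I_l -> 'I_(l * n) -> R) (A : 'M[R]_(n, l * n)) :
  blockAD x A \in unitmx <->
  (forall W : 'M_(l, n), (forall j, \sum_k \sum_i W k i * (x k j * A i j) = 0) -> W = 0).
Proof.
have mulW (W : 'I_l -> 'rV_n) j :
    (\mxrow_k W k *m \mxcol_k (A *m diag_mx (\row_j x k j))) 0 j =
    \sum_k \sum_i W k 0 i * (x k j * A i j).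
  rewrite mul_mxrow_mxcol summxE; apply: eq_bigr => k _; rewrite mxE.
  apply: eq_bigr => i _; rewrite mxE (bigD1 j) //= !mxE eqxx mulr1n big1 ?addr0 => [|j' /negPf nj].
    by rewrite [A i j * _]mulrC.
  by rewrite !mxE nj mulr0n mulr0.
rewrite -row_free_unit; split=> [/row_freeP_inj inj W W0 | inj].
  pose w := castmx (erefl, sum_const_nat l n) (\mxrow_k row k W).
  have: w = 0.
    apply: inj; rewrite mulmx_castmx_rows castmx_comp castmx_id; apply/rowP => j.
    rewrite mulW mxE -[RHS](W0 j); apply: eq_bigr => k _; apply: eq_bigr => i _.
    by rewrite mxE.
  move/(congr1 (castmx (erefl, esym (sum_const_nat l n)))).
  rewrite castmx_comp castmx_id castmx_const => w0.
  apply/row_matrixP => k; rewrite row0 -[LHS](mxrowK (fun k => row k W)) w0.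
  by apply/rowP => i; rewrite !mxE.
apply/row_freeP_inj => w.
rewrite mulmx_castmx_rows; set v := castmx _ w => wB.
suff v0: v = 0.
  have -> : w = castmx (erefl, sum_const_nat l n) v by rewrite castmx_comp castmx_id.
  by rewrite v0 castmx_const.
pose W := \matrix_(k, i) (submxrow v k) 0 i.
have W0 : W = 0.
  apply: inj => j; move/rowP/(_ j): wB; rewrite -[v]submxrowK mulW [RHS]mxE => vj; rewrite -[RHS]vj.
  by apply: eq_bigr => k _; apply: eq_bigr => i _; rewrite !mxE.
rewrite -[v]submxrowK -(@mxrow0 R l (fun _ : 'I_l => n) 1); apply/eq_mxrow => k.
by apply/rowP => i; move/matrixP/(_ k i): W0; rewrite !mxE.
Qed.

Lemma frakMP (Y : tensor R n l) :
  frakM Y <-> exists (x : 'I_l -> 'I_(l * n) -> R) (xm : 'I_(l * n) -> R) (A : 'M[R]_(n, l * n)),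
    (forall j, (\sum_k x k j *: Y k) *m col j A = xm j *: col j A) /\
    (forall W : 'M_(l, n), (forall j, \sum_k \sum_i W k i * (x k j * A i j) = 0) -> W = 0).
Proof.
split=> -[x [xm [A [E U]]]]; exists x, xm, A; (split; [move=> j | exact/blockAD_unitP]).
  by apply/eqP; rewrite -subr_eq0 -mul_scalar_mx -mulmxBl E.
by rewrite mulmxBl E mul_scalar_mx subrr.
Qed.

Lemma frakM_sub_frakS (Y : tensor R n l) : (0 < l)%N -> frakM Y -> frakS Y.
Proof.
move=> l0 /frakMP[x [xm [A [E U]]]]; split; last by move=> r B _; apply: rank_leq_row.
exists (l * n)%N, A; split=> [j|].
  exists (x^~ j), (xm j); split; last exact: E.
  (* If all [x k j] vanished, column [j] of the invertible block matrix would be zero. *)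
  left; apply/existsP; apply: contraT; rewrite negb_exists => /forallP x0.
  have BU : blockAD x A \in unitmx by apply/blockAD_unitP.
  suff B0 : blockAD x A *m delta_mx j 0 = 0 :> 'cV_(l * n).
    have /matrixP/(_ j 0)/eqP := mulKmx BU (delta_mx j 0 : 'cV_(l * n)).
    by rewrite B0 mulmx0 !mxE !eqxx eq_sym oner_eq0.
  rewrite -colE.
  apply/colP => c; rewrite !mxE castmxE /= !mxE big1 // => i _.
  rewrite !mxE cast_ord_id; case: eqP => [->|_]; rewrite ?mulr0n ?mulr0 //.
  by rewrite (eqP (negbNE (x0 _))) mulr1n mulr0.
apply/eqP; rewrite -/(row_free A); apply/row_freeP_inj => w wA.
pose k0 := Ordinal l0.
(* A relation [w] among the rows of [A], placed in block [k0], is a relation among the rows of the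
   block matrix. *)
have W0 : \matrix_(k < l, i < n) (w 0 i *+ (k == k0)) = 0.
  apply: U => j; rewrite (bigD1 k0) //= [X in _ + X]big1 => [|k /negPf nk]; last first.
    by rewrite big1 // => i _; rewrite mxE nk mul0r.
  rewrite addr0; move/rowP/(_ j): wA; rewrite !mxE => wA.
  rewrite [RHS](_ : 0 = x k0 j * \sum_i w 0 i * A i j); last by rewrite wA mulr0.
  rewrite mulr_sumr; apply: eq_bigr => i _.
  by rewrite mxE eqxx mulr1n mulrCA.
by apply/rowP => i; move/matrixP/(_ k0 i): W0; rewrite !mxE eqxx.
Qed.

End FrakM.

(** * Singular tensors and base changes *)

Lemma unitmx_row0 (F : fieldType) (n : nat) (v : 'rV[F]_n.+1) :
  v != 0 -> exists2 E : 'M_n.+1, E \in unitmx & row 0 E = v.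
Proof.
move=> v0; pose c := (col_ebase v) 0 0.
have vE : v = c *: row 0 (row_ebase v).
  have := mulmx_ebase v; rewrite rank_rV v0 [col_ebase v]mx11_scalar -/c => vE.
  rewrite -[LHS]vE -mulmxA mul_scalar_mx; congr (_ *: _).
  apply/rowP => j; rewrite !mxE (bigD1 0) //= big1 => [|i i0].
    by rewrite !mxE mul1r addr0.
  by rewrite !mxE -[(_ == _ :> nat)]/(0 == i) eq_sym (negPf i0) mul0r.
have c0 : c != 0 by apply: contraNneq v0 => c0; rewrite vE c0 scale0r.
exists (c *: row_ebase v); last by rewrite linearZ.
by rewrite unitmxZ ?unitfE // row_ebase_unit.
Qed.

(** Take a left kernel vector of [X] as first row of an invertible [E]. Then [E *m X] has zero first
    row, and [J] is conjugate by [E] to the sign change of the first coordinate. *)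
Lemma det0_reflection (F : fieldType) (n : nat) (X : 'M[F]_n.+1) :
  \det X = 0 -> exists2 J : 'M_n.+1, J *m X = X & \det J = -1.
Proof.
move=> /eqP/det0P[v /unitmx_row0[E Eu <-] EX].
pose d : 'rV[F]_n.+1 := \row_j (if j == 0 then -1 else 1).
exists (invmx E *m diag_mx d *m E); last first.
  rewrite !det_mulmx det_inv det_diag mulrAC mulVr -?unitmxE // mul1r.
  rewrite (bigD1 0) //= mxE eqxx big1 ?mulr1 // => i i0.
  by rewrite mxE (negPf i0).
rewrite -[in RHS](mulKmx Eu X) -!mulmxA; congr (_ *m _).
apply/matrixP => i j; rewrite mul_diag_mx [LHS]mxE [d _ _]mxE.
case: eqP => [->|_]; rewrite ?mul1r //.
suff -> : (E *m X) 0 j = 0 by rewrite mulr0.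
by move/rowP/(_ j): EX; rewrite -row_mul !mxE.
Qed.

Lemma horner_char_poly (F : comNzRingType) (n : nat) (A : 'M[F]_n) (x : F) :
  (char_poly A).[x] = \det (x%:M - A).
Proof.
rewrite -[LHS]/(horner_eval x _) -det_map_mx; congr (\det _).
apply/matrixP => i j; rewrite !mxE /= /horner_eval.
by rewrite hornerD hornerN hornerC hornerMn hornerX.
Qed.

Lemma near0_det_shift (R : rcfType) (n : nat) (X : 'M[R]_n) :
  near0 (fun e => \det (X + e%:M) != 0).
Proof.
have := near0_horner_neq0 (monic_neq0 (char_poly_monic (- X))).
by apply: near0_imp => e; rewrite horner_char_poly opprK addrC.
Qed.

Section Invariance.
Variables (R : rcfType).

(** A nonzero vector of [Vset Y] makes some [X = Mmat x xm Y] singular. For small [e > 0],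
    [X + e%:M] is nonsingular; if its determinant is positive, its product with the reflection [J],
    which is [X + e *: J], has negative determinant. *)
Lemma frakS_sub_eclosure_frakC (n l : nat) (Y : tensor R n.+1 l) :
  frakS Y -> eclosure (@frakC R n.+1 l) Y.
Proof.
move=> [[r [B [VB rB]]] _].
have [j vj] : exists j, col j B != 0.
  apply/existsP; apply: contraT; rewrite negb_exists => /forallP B0.
  suff B00 : B = 0 by move: rB; rewrite B00 mxrank0.
  by apply/matrixP => i j; move/negbNE/eqP/colP/(_ i): (B0 j); rewrite !mxE.
have [x [xm [xn0 xY]]] := VB j; set v := col j B in vj xY.
have [k0 xk0] : exists k, x k != 0.
  case: xn0 => // xm0; apply/existsP; apply: contraT; rewrite negb_exists => /forallP x0.
  move/esym/eqP: xY; rewrite big1 ?mul0mx ?scaler_eq0 ?(negPf vj) ?(negPf xm0) // => k _.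
  by rewrite (eqP (negbNE (x0 k))) scale0r.
pose X := Mmat x xm Y.
have [J JX Jd] : exists2 J, J *m X = X & \det J = -1.
  apply: det0_reflection; rewrite -det_tr; apply/eqP/det0P; exists v^T.
    by rewrite -(inj_eq (@trmx_inj _ _ _)) trmxK trmx0.
  by rewrite -trmx_mul mulmxBl xY mul_scalar_mx subrr trmx0.
(* Only slice [k0] moves, and the factor [(x k0)^-1] makes [X] change by exactly [e *: M]. *)
pose U (M : 'M[R]_n.+1) : tensor R n.+1 l := fun k => if k == k0 then (x k0)^-1 *: M else 0.
have XU e M : Mmat x xm (fun k => Y k + e *: U M k) = X + e *: M.
  rewrite /X /Mmat addrAC; congr (_ - _).
  transitivity (\sum_k (x k *: Y k + (if k == k0 then e *: M else 0))); last first.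
    by rewrite big_split /= -[X in _ + X = _]big_mkcond big_pred1_eq.
  apply: eq_bigr => k _; rewrite scalerDr /U; congr (_ + _); case: eqP => [->|_].
    by rewrite !scalerA mulrAC divff // mul1r.
  by rewrite !scaler0.
pose Z e := if \det (X + e%:M) < 0 then (fun k => Y k + e *: U 1%:M k)
            else (fun k => Y k + e *: U J k).
apply: (@eclosure_near0 _ _ _ _ _ Z) => [|e e0].
  apply: near0_imp (near0_det_shift X) => e dX.
  rewrite /Z; case: ltP => dX0; apply: eclosure_mem; exists x, xm; rewrite XU.
    by rewrite scalemx1.
  have -> : X + e *: J = J *m (X + e%:M) by rewrite mulmxDr JX mul_mx_scalar.
  by rewrite det_mulmx Jd mulN1r oppr_lt0 lt_neqAle eq_sym dX.
apply: near0_imp (near0_and (near0_line Y (U 1%:M) e0) (near0_line Y (U J) e0)) => z [].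
by rewrite /Z; case: ifP.
Qed.

(** Mixing slices by [invmx g] is Lipschitz and preserves [frakM]: the eigenvectors stay, the
    coefficients [x] are multiplied by [g], and a relation [W] for the new data gives [g *m W] for
    the old. *)
Lemma eclosure_frakM_mix (n l : nat) (g : 'M[R]_l) (Y : tensor R n l) :
  g \in unitmx ->
  eclosure (@frakM R n l) (fun k => \sum_i g k i *: Y i) -> eclosure (@frakM R n l) Y.
Proof.
move=> gu MY.
pose F (h : 'M[R]_l) (Z : tensor R n l) : tensor R n l := fun i => \sum_k h i k *: Z k.
have FF h h' Z i : F h (F h' Z) i = F (h *m h') Z i.
  rewrite /F; under eq_bigr => k _ do rewrite scaler_sumr.
  rewrite exchange_big /=; apply: eq_bigr => j _; rewrite mxE scaler_suml.
  by apply: eq_bigr => k _; rewrite scalerA.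
have F1 Z i : F 1%:M Z i = Z i.
  rewrite /F (bigD1 i) //= mxE eqxx scale1r big1 ?addr0 // => k ki.
  by rewrite mxE eq_sym (negPf ki) scale0r.
pose K := \sum_i \sum_k `|invmx g i k|.
have {MY} : eclosure (@frakM R n l) (F (invmx g) (F g Y)).
  apply: (eclosure_lipschitz (K := K)) MY => [|Z Z' d dZ k i j|Z /frakMP[x [xm [A [E U]]]]].
  - by rewrite /K !sumr_ge0 // => i _; rewrite sumr_ge0.
  - have d0 : 0 <= d by apply: le_trans (dZ k i j).
    have -> : F (invmx g) Z k i j - F (invmx g) Z' k i j
            = \sum_k' invmx g k k' * (Z k' i j - Z' k' i j).
      rewrite !summxE -sumrB; apply: eq_bigr => k' _.
      by rewrite !mxE mulrBr.
    apply: le_trans (ler_norm_sum _ _ _) _; rewrite /K [X in _ <= X * _](bigD1 k) //= mulrDl mulr_suml.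
    rewrite ler_wpDr ?mulr_ge0 ?sumr_ge0 // => [k' _|]; first by rewrite sumr_ge0.
    by apply: ler_sum => k' _; rewrite normrM ler_wpM2l.
  - apply/frakMP; exists (fun i j => \sum_k x k j * g k i), xm, A; split=> [j|W W0].
      rewrite -E; congr (_ *m _).
      transitivity (\sum_k x k j *: F g (F (invmx g) Z) k); last first.
        by apply: eq_bigr => k _; rewrite FF mulmxV // F1.
      under [RHS]eq_bigr => k _ do rewrite scaler_sumr.
      rewrite exchange_big; apply: eq_bigr => i _; rewrite scaler_suml.
      by apply: eq_bigr => k _; rewrite scalerA.
    rewrite -(mulKmx gu W) (U (g *m W)) ?mulmx0 // => j; rewrite -[RHS](W0 j).
    under eq_bigr => k _ do (under eq_bigr => i _ do rewrite mxE mulr_suml); rewrite /=.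
    under [RHS]eq_bigr => k _ do
      (under eq_bigr => i _ do rewrite mulr_suml mulr_sumr).
    rewrite exchange_big [RHS]exchange_big; apply: eq_bigr => i _ /=.
    rewrite exchange_big; apply: eq_bigr => k _; apply: eq_bigr => k' _.
    by ring.
move=> H e e0; have [Z [MZ YZ]] := H e e0; exists Z; split=> // k i j.
by rewrite -(F1 Y) -(mulVmx gu) -FF.
Qed.

(** Conjugating back keeps the coefficients and replaces the eigenvectors [A] by [invmx P *m A]; a
    relation [W] becomes [W *m invmx P]. *)
Lemma eclosure_frakM_conj (n l : nat) (P : 'M[R]_n) (Y : tensor R n l) :
  P \in unitmx ->
  eclosure (@frakM R n l) (fun k => P *m Y k *m invmx P) -> eclosure (@frakM R n l) Y.
Proof.
move=> Pu MY.
pose F (Z : tensor R n l) : tensor R n l := fun k => invmx P *m Z k *m P.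
pose K := (\sum_i \sum_a `|invmx P i a|) * (\sum_b \sum_j `|P b j|).
have {MY} : eclosure (@frakM R n l) (F (fun k => P *m Y k *m invmx P)).
  apply: (eclosure_lipschitz (K := K)) MY => [|Z Z' d dZ k i j|Z /frakMP[x [xm [A [E U]]]]].
  - by rewrite mulr_ge0 ?sumr_ge0 // => i _; rewrite sumr_ge0.
  - have d0 : 0 <= d by apply: le_trans (dZ k i j).
    have -> : F Z k i j - F Z' k i j
            = \sum_b (\sum_a invmx P i a * (Z k a b - Z' k a b)) * P b j.
      rewrite !mxE -sumrB; apply: eq_bigr => b _.
      rewrite !mxE -mulrBl -sumrB; congr (_ * _); apply: eq_bigr => a _.
      by rewrite mulrBr.
    pose K1 := \sum_i \sum_a `|invmx P i a|; pose K2 := \sum_b \sum_j `|P b j|.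
    have K1d : 0 <= K1 * d by rewrite mulr_ge0 // !sumr_ge0 // => a _; rewrite sumr_ge0.
    have H1 b : `|\sum_a invmx P i a * (Z k a b - Z' k a b)| <= K1 * d.
      apply: le_trans (ler_norm_sum _ _ _) _; rewrite /K1 [X in _ <= X * _](bigD1 i) //= mulrDl mulr_suml.
      rewrite ler_wpDr ?mulr_ge0 ?sumr_ge0 // => [a _|]; first by rewrite sumr_ge0.
      by apply: ler_sum => a _; rewrite normrM ler_wpM2l.
    have H2 : \sum_b `|P b j| <= K2.
      by apply: ler_sum => b _; rewrite [X in _ <= X](bigD1 j) //= ler_wpDr ?sumr_ge0.
    apply: le_trans (ler_norm_sum _ _ _) _.
    rewrite /K -/K1 -/K2 mulrAC; apply: le_trans (ler_wpM2l K1d H2).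
    by rewrite mulr_sumr; apply: ler_sum => b _; rewrite normrM ler_wpM2r.
  - apply/frakMP; exists x, xm, (invmx P *m A); split=> [j|W W0].
      rewrite !colE -mulmxA -!colE scalemxAr -E !mulmxA; congr (_ *m _); rewrite mulmx_sumr !mulmx_suml.
      by apply: eq_bigr => k _; rewrite -scalemxAl -scalemxAr /F mulmxK.
    rewrite -(mulmxKV Pu W) (U (W *m invmx P)) ?mul0mx // => j; rewrite -[RHS](W0 j).
    apply: eq_bigr => k _.
    transitivity (\sum_i \sum_a W k a * (x k j * (invmx P a i * A i j))).
      apply: eq_bigr => i _; rewrite mxE mulr_suml; apply: eq_bigr => a _; ring.
    rewrite exchange_big; apply: eq_bigr => a _; rewrite mxE !mulr_sumr.
    by apply: eq_bigr => i _.
move=> H e e0; have [Z [MZ YZ]] := H e e0; exists Z; split=> // k i j.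
rewrite (_ : Y k = F (fun k => P *m Y k *m invmx P) k) //.
by rewrite /F -!mulmxA mulVmx // mulmx1 mulKmx.
Qed.

End Invariance.

(** * Interpolation along a curve of approximate eigenvectors *)

(* Reduction of g modulo the polynomial with roots [e * y j] depends polynomially on e, and is
   truncation at e = 0. *)
Lemma scaled_interpolation (R : comNzRingType) (L : nat) (y : 'I_L -> R) (g : {poly R}) :
  {c : nat -> {poly R} | (forall i, (i < L)%N -> (c i).[0] = g`_i) /\
     forall e j, g.[e * y j] = \sum_(i < L) (c i).[e] * (e * y j) ^+ i}.
Proof.
case: L y => [|L] y; first by exists (fun=> 0); split=> // e [].
pose P := \prod_(j <- enum 'I_L.+1) ('X - (y j)%:P).
have sP : size P = L.+2 by rewrite size_prod_XsubC size_enum_ord.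
have Py j : y j ^+ L.+1 = - \sum_(i < L.+1) P`_i * y j ^+ i.
  have : P.[y j] = 0.
    by rewrite /P (bigD1_seq j) ?mem_enum ?enum_uniq //= hornerM hornerXsubC subrr mul0r.
  rewrite horner_coef sP big_ord_recr /=.
  have -> : P`_L.+1 = 1.
    by have := monic_prod_XsubC (enum 'I_L.+1) predT y; rewrite monicE lead_coefE -/P sP => /eqP.
  by rewrite mul1r addrC => /eqP; rewrite addr_eq0 => /eqP.
elim/poly_ind: g => [|p b [c [c0 cE]]].
  exists (fun=> 0); split=> [i _|e j]; first by rewrite horner0 coef0.
  by rewrite horner0 big1 // => i _; rewrite horner0 mul0r.
exists (fun i => (if i is i'.+1 then c i' else b%:P) - P`_i *: (c L * 'X^(L.+1 - i))).
split=> [i iL|e j].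
  rewrite hornerD hornerN hornerZ hornerM hornerXn expr0n subn_eq0 leqNgt iL /= !mulr0 subr0.
  rewrite coefD coefMX coefC; case: i iL => [|i] iL /=; first by rewrite hornerC add0r.
  by rewrite c0 ?addr0 // ltnW.
rewrite hornerMXaddC cE; set z := e * y j.
under [RHS]eq_bigr => i _ do rewrite hornerD mulrDl.
rewrite big_split /= [X in _ = X + _]big_ord_recl /= hornerC expr0 mulr1.
rewrite mulr_suml [X in X + _ = _]big_ord_recr /=.
have zL : z ^+ L.+1 = - \sum_(i < L.+1) P`_i * e ^+ (L.+1 - i) * z ^+ i.
  rewrite exprMn Py mulrN mulr_sumr; congr (- _); apply: eq_bigr => i _.
  rewrite exprMn -{1}(subnK (ltnW (ltn_ord i))) exprD; ring.
rewrite -mulrA -exprSr zL mulrN mulr_sumr -sumrN addrAC [X in X + _ = _]addrC. congr (_ + _ + _).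
  by apply: eq_bigr => i _; rewrite /bump /= add1n -mulrA -exprSr.
by apply: eq_bigr => i _; rewrite hornerN hornerZ hornerM hornerXn; ring.
Qed.

Lemma Vandermonde_unit (F : fieldType) (L : nat) (z : 'I_L -> F) :
  injective z -> \matrix_(i < L, j < L) z j ^+ i \in unitmx.
Proof.
move=> inj_z; rewrite unitmxE unitfE.
have -> : \matrix_(i < L, j < L) z j ^+ i = Vandermonde L (\row_j z j).
  by apply/matrixP => i j; rewrite !mxE.
rewrite det_Vandermonde; apply/prodf_neq0 => i _; apply/prodf_neq0 => j ij.
rewrite !mxE subr_eq0 (inj_eq inj_z); apply: contraTneq ij => ->.
by rewrite ltnn.
Qed.

Section Curve.
Variables (R : rcfType) (n l : nat) (Y : tensor R n l).
Variables (x : 'I_l -> {poly R}) (t : {poly R}) (a : 'I_n -> {poly R}).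
Let L := (l * n)%N.
Let res i := \sum_k x k * (\sum_i' (Y k i i')%:P * a i') - t * a i.
Hypothesis res0 : forall i j, (j < L)%N -> (res i)`_j = 0.
Hypothesis indep : forall W : 'M[R]_(l, n),
  (forall j : 'I_L, \sum_k \sum_i W k i * (x k * a i)`_j = 0) -> W = 0.

(** Interpolation at [z j = e * y j] writes the vectors [x (x) a] as the columns of [T = B^T V] and
    the residuals as [D V], with [V] a Vandermonde matrix. The correction has to solve
    [Zm *m T = - D V]; here [V] cancels, and [Zm] tends to 0 with [e], because [D] vanishes at 0 by
    [res0] while [B] is invertible there by [indep]. *)
Lemma eclosure_frakM_curve : eclosure (@frakM R n l) Y.
Proof.
pose y (j : 'I_L) : R := j.+1%:R.
pose c k i := sval (scaled_interpolation y (x k * a i)).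
have c0 k i (j : 'I_L) : (c k i j).[0] = (x k * a i)`_j.
  by rewrite /c; case: scaled_interpolation => ? [/= -> //].
have cE k i e j : (x k).[e * y j] * (a i).[e * y j]
                  = \sum_(i' < L) (c k i i').[e] * (e * y j) ^+ i'.
  by rewrite -hornerM /c; case: scaled_interpolation => ? [/= _ ->].
pose d i := sval (scaled_interpolation y (res i)).
have d0 i (j : 'I_L) : (d i j).[0] = 0.
  by rewrite /d; case: scaled_interpolation => ? [/= -> // _]; apply: res0.
have dE i e j : (res i).[e * y j] = \sum_(i' < L) (d i i').[e] * (e * y j) ^+ i'.
  by rewrite /d; case: scaled_interpolation => ? [/= _ ->].
pose B : 'M[{poly R}]_L := \matrix_(j < L) mxvec (\matrix_(k, i) c k i j).
have BE j k i : B j (mxvec_index k i) = c k i j by rewrite mxE mxvecE mxE.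
pose D : 'M[{poly R}]_(n, L) := \matrix_(i, j) d i j.
have dB0 : (\det B^T).[0] != 0.
  rewrite -[_.[0]]/(horner_eval 0 _) -det_map_mx -unitfE -unitmxE -matrix.map_trmx.
  apply/mxvec_unitP => W W0; apply: indep => j; rewrite -[RHS](W0 j).
  apply: eq_bigr => k _; apply: eq_bigr => i _.
  by rewrite [in RHS]mxE BE /= /horner_eval c0.
pose Zm e : 'M[R]_(n, L) := - (map_mx (horner_eval e) D *m invmx (map_mx (horner_eval e) B^T)).
pose Z e : tensor R n l := fun k => \matrix_(i, i') (Y k i i' + Zm e i (mxvec_index k i')).
have detB : \det B^T != 0 by apply: contraNneq dB0 => ->; rewrite horner0.
apply: (@eclosure_near0 _ _ _ _ _ Z) => [|eps eps0]; last first.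
  apply: near0_forall => k; apply: near0_forall => i; apply: near0_forall => i'.
  (* By Cramer's rule each entry of the correction is a quotient whose numerator vanishes at 0 and
     whose denominator does not. *)
  pose p := (D *m \adj B^T) i (mxvec_index k i').
  have p0 : p.[0] = 0.
    rewrite /p mxE horner_sum big1 // => j _.
    by rewrite hornerM mxE d0 mul0r.
  apply: near0_imp (near0_and (near0_horner_neq0 detB) (near0_frac_lt p0 dB0 eps0)) => e [dBe].
  suff -> : Y k i i' - Z e k i i' = p.[e] / (\det B^T).[e] by [].
  rewrite [Z e k i i']mxE opprD addNKr [Zm e i _]mxE opprK /invmx unitmxE det_map_mx unitfE dBe.
  rewrite -scalemxAr mxE mulrC -map_mx_adj -map_mxM mxE; congr (_ / _).
apply: near0_imp (near0_and (near0_horner_neq0 detB) (near0_pos R)) => e [dBe e0].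
apply: eclosure_mem; apply/frakMP.
have Beu : map_mx (horner_eval e) B^T \in unitmx by rewrite unitmxE det_map_mx unitfE.
pose z j := e * y j.
have Vu : \matrix_(i < L, j < L) z j ^+ i \in unitmx.
  apply: Vandermonde_unit => j j' /(mulfI (lt0r_neq0 e0)) /eqP.
  by rewrite eqr_nat eqSS => /eqP/val_inj.
set V := (X in X \in _) in Vu.
pose T := map_mx (horner_eval e) B^T *m V.
have TE k i j : T (mxvec_index k i) j = (x k).[z j] * (a i).[z j].
  rewrite cE mxE; apply: eq_bigr => i' _.
  by rewrite 2!mxE [V _ _]mxE /= /horner_eval BE.
exists (fun k j => (x k).[z j]), (fun j => t.[z j]), (\matrix_(i, j) (a i).[z j]).
split=> [j|W W0]; last first.
  have Tu : T^T^T \in unitmx by rewrite trmxK unitmx_mul Beu.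
  apply: (iffLR (mxvec_unitP _) Tu) => j; rewrite -[RHS](W0 j).
  by apply: eq_bigr => k _; apply: eq_bigr => i _; rewrite [T^T _ _]mxE TE mxE.
apply/colP => i; rewrite ![in RHS]mxE.
have -> : (\sum_k (x k).[z j] *: Z e k) *m col j (\matrix_(i, j) (a i).[z j]) =
          \col_i (\sum_k (x k).[z j] * \sum_i' Z e k i i' * (a i').[z j]).
  apply/colP => i0; rewrite mulmx_suml summxE mxE; apply: eq_bigr => k _.
  by rewrite -scalemxAl !mxE; congr (_ * _); apply: eq_bigr => i' _; rewrite !mxE.
rewrite mxE; apply/eqP; rewrite -subr_eq0; apply/eqP.
(* Moving [Y] by [Zm] adds [Zm *m T] to the residuals, which cancels them. *)
transitivity ((res i).[z j] + (Zm e *m T) i j).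
  rewrite hornerD hornerN hornerM addrAC; congr (_ - _).
  have -> : (Zm e *m T) i j =
      \sum_k \sum_i' Zm e i (mxvec_index k i') * T (mxvec_index k i') j.
    rewrite mxE pair_bigA /= (reindex _ (curry_mxvec_bij l n)) /=.
    by apply: eq_bigr => -[k i'].
  rewrite horner_sum.
  rewrite -big_split; apply: eq_bigr => k _ /=.
  rewrite hornerM horner_sum !mulr_sumr -big_split; apply: eq_bigr => i' _ /=.
  rewrite hornerM hornerC TE mxE; ring.
rewrite /T mulNmx mulmxA mulmxKV // mxE dE mxE.
apply/eqP; rewrite subr_eq0; apply/eqP; apply: eq_bigr => i' _.
by rewrite mxE [V _ _]mxE mxE.
Qed.

End Curve.

(** * Hensel lifting *)

Lemma horner_add_taylor2 (A : comNzRingType) (p : {poly A}) (x h : A) :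
  exists c, p.[x + h] = p.[x] + p^`().[x] * h + h ^+ 2 * c.
Proof.
elim/poly_ind: p => [|p b [c E]].
  by exists 0; rewrite derivC !horner0 mul0r mulr0 !addr0.
exists (p^`().[x] + c * (x + h)).
rewrite derivD derivM derivX derivC addr0 mulr1 !hornerE E; ring.
Qed.

Lemma horner0_dvdX (A : comNzRingType) (p : {poly A}) : p.[0] = 0 -> exists q, p = 'X * q.
Proof.
move=> p0; have /factor_theorem[q ->] : root p 0 by apply/rootP.
by exists q; rewrite subr0 mulrC.
Qed.

Section Hensel.
Variables (A : comNzRingType) (chi : {poly {poly A}}) (r kappa : A).
Let chi0 := map_poly (horner_eval 0) chi.
Hypothesis chi0r : chi0.[r] = 0.
Hypothesis dchi0r : chi0^`().[r] * kappa = 1.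

Let horner_at0 (p : {poly {poly A}}) t : p.[t].[0] = (map_poly (horner_eval 0) p).[t.[0]].
Proof. by rewrite -[t.[0]]/(horner_eval 0 t) horner_map. Qed.

(** Newton iteration with the fixed inverse [kappa]: subtracting ['X^(k.+1)] times [kappa * e.[0]]
    removes the constant term of [e]. [A] is only a ring, so that the lift can depend polynomially
    on a further parameter. *)
Lemma hensel_exists k : exists t e, t.[0] = r /\ chi.[t] = 'X^(k.+1) * e.
Proof.
elim: k => [|k [t [e [t0 te]]]].
  have [e rE] : exists e, chi.[r%:P] = 'X * e.
    by apply: horner0_dvdX; rewrite horner_at0 hornerC.
  by exists r%:P, e; rewrite hornerC expr1.
have [c E] := horner_add_taylor2 chi t (- ('X^(k.+1) * (kappa * e.[0])%:P)).
have [f fE] : exists f, e - chi^`().[t] * (kappa * e.[0])%:P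
     + 'X^(k.+1) * (kappa * e.[0])%:P ^+ 2 * c = 'X * f.
  apply: horner0_dvdX; rewrite !(hornerD, hornerN, hornerM) hornerXn expr0n !mul0r addr0.
  by rewrite hornerC horner_at0 -deriv_map t0 mulrA dchi0r mul1r subrr.
exists (t - 'X^(k.+1) * (kappa * e.[0])%:P), f; split.
  by rewrite hornerD hornerN hornerM hornerXn expr0n mul0r subr0.
rewrite E te [in RHS]exprSr -[in RHS]mulrA -fE; ring.
Qed.

(** In [chi(t) - chi(t') = (t - t') (chi'(t') + (t - t') c)] the last factor has an invertible
    constant term, so the power of ['X] dividing [t - t'] climbs up to [k]. *)
Lemma hensel_unique k t t' e e' :
  t.[0] = r -> t'.[0] = r -> chi.[t] = 'X^k * e -> chi.[t'] = 'X^k * e' ->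
  exists h, t - t' = 'X^k * h.
Proof.
move=> t0 t0' te te'.
suff: forall j, (j <= k)%N -> exists h, t - t' = 'X^j * h by apply.
elim=> [_|j IH jk]; first by exists (t - t'); rewrite mul1r.
have [h hE] := IH (ltnW jk).
have [c E] := horner_add_taylor2 chi t' (t - t').
move: E; rewrite subrKC te te' => E.
have {}E : 'X^j * (h * (chi^`().[t'] + (t - t') * c)) = 'X^j * ('X^(k - j) * (e - e')).
  rewrite mulrA -hE mulrA -exprD subnKC ?(ltnW jk) // mulrBr E; ring.
(* [A] may have zero divisors, but the monic ['X^j] is regular. *)
move: E => /(monic_lreg (monicXn _ _)) /(congr1 (horner_eval 0)).
rewrite /horner_eval !hornerM hornerXn expr0n subn_eq0 leqNgt jk mul0r.
rewrite !(hornerD, hornerN, hornerM) t0 t0' subrr mul0r addr0 horner_at0 -deriv_map t0' => h0.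
have [f fE] : exists f, h = 'X * f.
  by apply: horner0_dvdX; rewrite -[LHS]mulr1 -dchi0r mulrA h0 mul0r.
by exists f; rewrite hE fE mulrA -exprSr.
Qed.

End Hensel.

(** * Companion matrices *)

(** Coefficients in the last row make the columns [(1, t, ..., t^n)] right eigenvectors at the roots
    [t]. *)
Definition companion (A : nzRingType) (n : nat) (p : {poly A}) : 'M[A]_n.+1 :=
  \matrix_(i, j) if i == n :> nat then - p`_j else (i.+1 == j :> nat)%:R.

Lemma char_poly_companion (A : comNzRingType) (n : nat) (p : {poly A}) :
  p \is monic -> size p = n.+2 -> char_poly (companion n p) = p.
Proof.
move=> pm sp; rewrite -[RHS](companionmxK pm).
have -> : companion n p =
    \matrix_(i, j) if i == n.+1.-1 :> nat then - p`_j else (i.+1 == j :> nat)%:R by [].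
by have -> : n.+1 = (size p).-1 by rewrite sp.
Qed.

Lemma map_companion (A B : nzRingType) (f : {rmorphism A -> B}) (n : nat) (p : {poly A}) :
  map_mx f (companion n p) = companion n (map_poly f p).
Proof.
by apply/matrixP => i j; rewrite !mxE coef_map; case: ifP; rewrite ?rmorphN ?rmorph_nat.
Qed.

Lemma scalar_sub_companion_powers (A : comNzRingType) (n : nat) (p : {poly A}) (t : A) :
  p \is monic -> size p = n.+2 ->
  (t%:M - companion n p) *m (\col_i t ^+ i) = p.[t] *: delta_mx ord_max (0 : 'I_1).
Proof.
move=> pm sp; apply/colP => i.
rewrite mulmxBl mul_scalar_mx !mxE eqxx andbT -exprS -[_ == ord_max]/(i == n :> nat).
under eq_bigr => j _ do rewrite !mxE.
case: (altP (i =P n :> nat)) => [->|/negPf ni].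
  rewrite mulr1 horner_coef sp [RHS]big_ord_recr /=.
  have -> : p`_n.+1 = 1 by move: pm; rewrite monicE lead_coefE sp => /eqP.
  rewrite mul1r addrC -sumrN; congr (_ + _).
  by apply: eq_bigr => j _; rewrite mulNr opprK.
have iN : (i.+1 < n.+1)%N by rewrite ltnS ltn_neqAle ni /= -ltnS.
rewrite (bigD1 (Ordinal iN)) //= eqxx mul1r big1 ?addr0 => [|j /negPf nj].
  by rewrite subrr mulr0.
by rewrite eq_sym -[(j == i.+1 :> nat)]/(j == Ordinal iN) nj mul0r.
Qed.

(* For t = 'X, cancel the regular element p.['X] = p in adj(M) M (powers) = p adj(M) e_last; then
   specialise 'X to t. *)
Lemma adj_companion_last (A : comNzRingType) (n : nat) (p : {poly A}) (t : A) (i : 'I_n.+1) :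
  p \is monic -> size p = n.+2 -> (\adj (t%:M - companion n p)) i ord_max = t ^+ i.
Proof.
move=> pm sp; pose P := map_poly polyC p; pose M := 'X%:M - companion n P.
have Pm : P \is monic by rewrite monicE (lead_coef_map_inj (@polyC_inj A)) // (monicP pm).
have sP : size P = n.+2 by rewrite size_map_polyC.
have PX : P.['X] = p.
  by rewrite -[RHS]comp_polyXr /comp_poly.
have detM : \det M = p by rewrite -horner_char_poly char_poly_companion.
have adjM j : (\adj M) j ord_max = 'X^j.
  have /(congr1 (mulmx (\adj M))) := scalar_sub_companion_powers 'X Pm sP.
  rewrite -/M mulmxA mul_adj_mx detM PX mul_scalar_mx -scalemxAr -colE => /colP/(_ j).
  by rewrite !mxE => /(monic_lreg pm).
have -> : t%:M - companion n p = map_mx (horner_eval t) M.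
  rewrite map_mxB map_scalar_mx map_companion; congr (_%:M - companion n _).
    by rewrite /= /horner_eval hornerX.
  by apply/polyP => j; rewrite !coef_map /= /horner_eval hornerC.
by rewrite -map_mx_adj mxE adjM /= /horner_eval hornerXn.
Qed.

(** * Expansions in powers of a polynomial [q] *)

Section QAdic.
Variables (R : fieldType) (n : nat) (q : {poly R}).
Hypothesis sq : size q = n.+2.

Lemma size_qadic (l : nat) (u : 'I_l -> {poly R}) :
  (forall k, (size (u k) <= n.+1)%N) -> (size (\sum_k u k * q ^+ k)%R <= l * n.+1)%N.
Proof.
elim: l u => [|l IH] u su; first by rewrite big_ord0 size_poly0.
rewrite big_ord_recl mulr1.
have -> : \sum_(i < l) u (lift ord0 i) * q ^+ lift ord0 i
        = q * \sum_(i < l) u (lift ord0 i) * q ^+ i.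
  by rewrite mulr_sumr; apply: eq_bigr => i _; rewrite /= /bump /= exprS mulrCA.
apply: (leq_trans (size_polyD _ _)); rewrite geq_max mulSn.
rewrite (leq_trans (su _)) ?leq_addr //=.
apply: (leq_trans (size_polyMleq _ _)); rewrite sq /=.
by rewrite leq_add2l IH.
Qed.

(** The lowest digit is a multiple of [q] of smaller size than [q], so it and the remaining sum both
    vanish; then induct on the number of digits. *)
Lemma qadic_inj (l : nat) (u : 'I_l -> {poly R}) :
  (forall k, (size (u k) <= n.+1)%N) -> \sum_k u k * q ^+ k = 0 -> forall k, u k = 0.
Proof.
elim: l u => [|l IH] u su; first by move=> _ [].
rewrite big_ord_recl mulr1.
have -> : \sum_(i < l) u (lift ord0 i) * q ^+ lift ord0 i
        = q * \sum_(i < l) u (lift ord0 i) * q ^+ i.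
  by rewrite mulr_sumr; apply: eq_bigr => i _; rewrite /= /bump /= exprS mulrCA.
set v := \sum_(i < l) _ => E.
have q0 : q != 0 by rewrite -size_poly_gt0 sq.
have v0 : v = 0.
  apply/eqP; apply: contraT => v0.
  have : (size (q * v)%R <= n.+1)%N.
    by move/eqP: E; rewrite addrC addr_eq0 => /eqP->; rewrite size_polyN.
  by rewrite size_mul // sq addSn /= -[X in (_ <= X)%N]addn0 leq_add2l leqn0 size_poly_eq0 (negPf v0).
move=> k; case: (unliftP ord0 k) => [k' ->|->].
  by apply: (IH (fun i => u (lift ord0 i))) v0 _ => i; apply: su.
by move: E; rewrite v0 mulr0 addr0.
Qed.

End QAdic.

(** * Pencils along a curve *)

Section Pencil.
Variables (A : comNzRingType) (n l : nat).
Implicit Types (x : 'I_l -> {poly A}) (Y : 'I_l -> 'M[A]_n.+1) (t : {poly A}).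

Definition pencil x Y : 'M[{poly A}]_n.+1 := \sum_k x k *: map_mx polyC (Y k).

(** A column of the adjugate is an eigenvector up to an error [(char_poly N).[t]]; being polynomial
    in [N] and [t], it commutes with specialisation. *)
Definition adjcol (N : 'M[{poly A}]_n.+1) t (i : 'I_n.+1) := (\adj (t%:M - N)) i ord_max.

(** Independence of the first Taylor coefficients of [x (x) a] becomes the nonvanishing of one
    determinant. *)
Definition coefmx x (a : 'I_n.+1 -> {poly A}) : 'M[A]_(l * n.+1) :=
  \matrix_j mxvec (\matrix_(k, i) (x k * a i)`_j).

Lemma pencil_adjcol x Y t i :
  \sum_k x k * (\sum_i' (Y k i i')%:P * adjcol (pencil x Y) t i') - t * adjcol (pencil x Y) t i
  = - ((i == ord_max)%:R * (char_poly (pencil x Y)).[t]).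
Proof.
set N := pencil x Y; pose a := \col_i adjcol N t i.
have aE : (t%:M - N) *m a = (char_poly N).[t] *: delta_mx ord_max (0 : 'I_1).
  have -> : a = col ord_max (\adj (t%:M - N)) by apply/colP => j; rewrite !mxE.
  by rewrite colE mulmxA mul_mx_adj mul_scalar_mx horner_char_poly.
have /colP/(_ i) := aE; rewrite mulmxBl mul_scalar_mx !mxE eqxx andbT => H.
rewrite [X in _ = - X]mulrC -H opprB; congr (_ - _).
rewrite /N /pencil; under [RHS]eq_bigr => j _ do rewrite summxE mulr_suml.
rewrite exchange_big; apply: eq_bigr => k _; rewrite mulr_sumr; apply: eq_bigr => j _.
by rewrite !mxE mulrA.
Qed.

Lemma pencil_at0 x Y k0 :
  (forall k, (x k).[0] = (k == k0)%:R) -> map_mx (horner_eval 0) (pencil x Y) = Y k0.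
Proof.
move=> x0; apply/matrixP => i j.
rewrite mxE /= summxE /horner_eval horner_sum (bigD1 k0) //= big1 => [|k kk].
  by rewrite !mxE hornerM x0 eqxx mul1r hornerC addr0.
by rewrite !mxE hornerM x0 (negPf kk) mul0r.
Qed.

End Pencil.

Section MapPencil.
Variables (A B : comNzRingType) (f : {rmorphism A -> B}) (n l : nat).

(** This and the next two lemmas serve to specialise the parameter of a path of tensors. *)
Lemma map_pencil (x : 'I_l -> {poly A}) (Y : 'I_l -> 'M[A]_n.+1) :
  map_mx (map_poly f) (pencil x Y) = pencil (fun k => map_poly f (x k)) (fun k => map_mx f (Y k)).
Proof.
apply/matrixP => i j; rewrite mxE !summxE rmorph_sum; apply: eq_bigr => k _.
by rewrite !mxE rmorphM /= map_polyC.
Qed.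

Lemma map_adjcol (N : 'M[{poly A}]_n.+1) t i :
  map_poly f (adjcol N t i) = adjcol (map_mx (map_poly f) N) (map_poly f t) i.
Proof.
by rewrite /adjcol -(map_scalar_mx (map_poly f)) -map_mxB -map_mx_adj [RHS]mxE.
Qed.

Lemma map_coefmx (x : 'I_l -> {poly A}) (a : 'I_n.+1 -> {poly A}) :
  map_mx f (coefmx x a) = coefmx (fun k => map_poly f (x k)) (fun i => map_poly f (a i)).
Proof.
apply/matrixP => j c; case/mxvec_indexP: c => k i.
by rewrite !mxE !mxvecE !mxE -rmorphM coef_map.
Qed.

End MapPencil.

Lemma coefmx_unitP (R : fieldType) (n l : nat) (x : 'I_l -> {poly R}) (a : 'I_n.+1 -> {poly R}) :
  coefmx x a \in unitmx <->
  (forall W : 'M_(l, n.+1),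
     (forall j : 'I_(l * n.+1), \sum_k \sum_i W k i * (x k * a i)`_j = 0) -> W = 0).
Proof.
rewrite -unitmx_tr; split=> [/mxvec_unitP U W W0|U].
  apply: U => j; rewrite -[RHS](W0 j); apply: eq_bigr => k _; apply: eq_bigr => i _.
  by rewrite mxE mxvecE mxE.
apply/mxvec_unitP => W W0; apply: U => j; rewrite -[RHS](W0 j).
apply: eq_bigr => k _; apply: eq_bigr => i _; by rewrite mxE mxvecE mxE.
Qed.

Lemma coef_Xn_mul_lt (A : nzRingType) (L j : nat) (e : {poly A}) : (j < L)%N -> ('X^L * e)`_j = 0.
Proof. by move=> jL; rewrite coefXnM jL. Qed.

(** The characteristic polynomial [p - q] of [N] has the exact root [z = 'X + r], so [t] agrees with
    [z] modulo ['X^(l * n.+1)] by uniqueness of the lift, and the eigenvector consists of the powers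
    [t^i]. A relation [W] thus becomes a vanishing expansion in powers of [q]. *)
Lemma model_coefmx_unit (R : fieldType) (n l : nat) (p : {poly R}) (r : R) (t e : {poly R}) :
  p \is monic -> size p = n.+2 -> p.[r] = 0 -> p^`().[r] != 0 ->
  let q := p \Po ('X + r%:P) in
  let N := companion n (map_poly polyC p - q%:P) in
  t.[0] = r -> (char_poly N).[t] = 'X^(l * n.+1) * e ->
  coefmx (fun k : 'I_l => q ^+ k) (adjcol N t) \in unitmx.
Proof.
move=> pm sp pr dpr q N t0 te.
pose z : {poly R} := 'X + r%:P.
have sz : size z = 2 by rewrite size_XaddC.
have sq : size q = n.+2 by rewrite size_comp_poly2.
have q0 : q.[0] = 0 by rewrite horner_comp !hornerE.
set P := map_poly polyC p - q%:P in N te *.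
have sP0 : size (map_poly polyC p) = n.+2 by rewrite size_map_polyC.
have sqP : (size (- q%:P) < size (map_poly polyC p))%N.
  by rewrite size_polyN sP0 ltnS (leq_trans (size_polyC_leq1 _)).
have sP : size P = n.+2 by rewrite size_polyDl.
have Pm : P \is monic.
  by rewrite monicE lead_coefDl // (lead_coef_map_inj (@polyC_inj R)) // (monicP pm).
have chiE : char_poly N = P by rewrite char_poly_companion.
have chi0 : map_poly (horner_eval 0) (char_poly N) = p.
  rewrite chiE rmorphB /= map_polyC /= [horner_eval 0 q]q0 subr0.
  by apply/polyP => j; rewrite !coef_map /= /horner_eval hornerC.
have zE : (char_poly N).[z] = 'X^(l * n.+1) * 0.
  by rewrite mulr0 chiE hornerD hornerN hornerC -/(comp_poly z p) subrr.
have z0 : z.[0] = r by rewrite !hornerE.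
have [h hE] : exists h, t - z = 'X^(l * n.+1) * h.
  apply: (hensel_unique (r := r) (kappa := (p^`().[r])^-1) _ t0 z0 te zE).
  by rewrite chi0 mulfV.
apply/coefmx_unitP => W W0.
(* Row [k] of [W], read as a polynomial in [z] of degree below that of [q], is the [k]-th digit. *)
pose u k := (\poly_(i < n.+1) W k (inord i)) \Po z.
have uE k : u k = \sum_i W k i *: z ^+ i.
  rewrite /u poly_def rmorph_sum /=; apply: eq_bigr => i _.
  by rewrite comp_polyZ comp_Xn_poly inord_val.
have su k : (size (u k) <= n.+1)%N by rewrite size_comp_poly2 ?size_poly.
have suL := size_qadic sq su.
have S0 : \sum_k u k * q ^+ k = 0.
  (* Coefficients from [l * n.+1] on vanish by size, the lower ones by [W0]. *)
  apply/polyP => j; rewrite coef0; case: (ltnP j (l * n.+1)) => [jL|jL]; last first.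
    by rewrite nth_default // (leq_trans suL).
  rewrite -[RHS](W0 (Ordinal jL)) coef_sum; apply: eq_bigr => k _.
  rewrite uE mulr_suml coef_sum; apply: eq_bigr => i _.
  rewrite -scalerAl coefZ; congr (_ * _); rewrite /adjcol adj_companion_last //.
  have -> : t = z + 'X^(l * n.+1) * h by rewrite -hE addrC subrK.
  have [c] := horner_add_taylor2 'X^i z ('X^(l * n.+1) * h).
  rewrite !hornerXn => ->; set d := _.[z].
  have -> : q ^+ k * (z ^+ i + d * ('X^(l * n.+1) * h) + ('X^(l * n.+1) * h) ^+ 2 * c) =
    z ^+ i * q ^+ k + 'X^(l * n.+1) * (q ^+ k * h * (d + 'X^(l * n.+1) * h * c)) by ring.
  by rewrite coefD coef_Xn_mul_lt ?addr0.
have u0 := qadic_inj sq su S0.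
apply/matrixP => k i; rewrite mxE.
have /eqP : u k = 0 by apply: u0.
rewrite /u comp_poly2_eq0 // => /eqP/polyP/(_ i).
by rewrite coef_poly ltn_ord inord_val coef0.
Qed.

(** * Deformation to the model tensor *)

Section Path.
Variables (R : rcfType) (n l : nat).

(** On the line [Y + s D] to the model, the determinant deciding independence is a polynomial in [s]
    that is nonzero at [s = 1], hence nonzero for all small [s > 0]. *)
Lemma eclosure_frakM_companion (Y : tensor R n.+1 l.+2) (p : {poly R}) (r : R) :
  p \is monic -> size p = n.+2 -> Y ord0 = companion n p -> p.[r] = 0 -> p^`().[r] != 0 ->
  eclosure (@frakM R n.+1 l.+2) Y.
Proof.
move=> pm sp Y0 pr dpr.
pose q := p \Po ('X + r%:P).
have q0 : q.[0] = 0 by rewrite horner_comp !hornerE.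
pose L := (l.+2 * n.+1)%N.
pose x (k : 'I_l.+2) := q ^+ k.
have x0 k : (x k).[0] = (k == ord0)%:R by rewrite horner_exp q0 expr0n.
(* Slice 0 is fixed; at [s = 1] slice 1 is a matrix unit and the later slices are 0. *)
pose D : tensor R n.+1 l.+2 := fun k => if k == ord0 then 0 else
  (if k == 1%N :> nat then delta_mx ord_max ord0 else 0) - Y k.
(* Two variables: the coefficient ring [{poly R}] carries [s], the outer variable is the parameter
   of the curve. *)
pose Yp k := map_mx polyC (Y k) + 'X *: map_mx polyC (D k).
pose xp k := map_poly polyC (x k).
pose N := pencil xp Yp.
have evC (s : R) (u : {poly R}) : map_poly (horner_eval s) (map_poly polyC u) = u.
  by apply/polyP => j; rewrite !coef_map /= /horner_eval hornerC.
have evY s k : map_mx (horner_eval s) (Yp k) = Y k + s *: D k.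
  by apply/matrixP => i j; rewrite !mxE /= /horner_eval hornerD hornerM hornerX !hornerC.
have evN s : map_mx (map_poly (horner_eval s)) N = pencil x (fun k => Y k + s *: D k).
  rewrite map_pencil; apply: eq_bigr => k _; by rewrite evC evY.
(* At the origin of the curve the pencil is [Y ord0] for every [s], so one lift of [r] serves the
   whole path. *)
have chi0 : map_poly (horner_eval 0) (char_poly N) = map_poly polyC p.
  rewrite map_char_poly (@pencil_at0 _ _ _ _ _ ord0) => [|k]; last first.
    by rewrite -[0]/(polyC 0) horner_map x0 /= rmorph_nat.
  rewrite /Yp /D eqxx raddf0 scaler0 addr0 Y0 map_companion char_poly_companion //.
    by rewrite monicE (lead_coef_map_inj (@polyC_inj R)) // (monicP pm).
  by rewrite size_map_polyC.
have [t [e [t0 te]]] : exists t e, t.[0] = r%:P /\ (char_poly N).[t] = 'X^L * e.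
  apply: (@hensel_exists _ _ _ (p^`().[r])^-1%:P); rewrite chi0.
    by rewrite horner_map /= pr.
  by rewrite deriv_map horner_map /= -polyCM mulfV.
pose ts s := map_poly (horner_eval s) t.
have ts0 s : (ts s).[0] = r.
  have := horner_map (horner_eval s) t 0; rewrite t0 /=.
  by rewrite /ts [horner_eval s 0]horner0 [horner_eval s _]hornerC.
have tsE s : (char_poly (pencil x (fun k => Y k + s *: D k))).[ts s]
             = 'X^L * map_poly (horner_eval s) e.
  rewrite -evN -map_char_poly horner_map te rmorphM /= map_polyXn //.
pose Q := coefmx xp (adjcol N t).
have evQ s : map_mx (horner_eval s) Q
             = coefmx x (adjcol (pencil x (fun k => Y k + s *: D k)) (ts s)).
  rewrite map_coefmx; apply/matrixP => i j; rewrite !mxE; congr (mxvec _ _ _).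
  by apply/matrixP => k i'; rewrite !mxE evC map_adjcol evN.
have Qn0 : \det Q != 0.
  suff : \det (map_mx (horner_eval 1) Q) != 0.
    by apply: contraNneq; rewrite det_map_mx => ->; rewrite /= /horner_eval horner0.
  rewrite evQ -unitfE -unitmxE.
  (* Adding [q] in the lower left corner of the companion matrix of [p] subtracts [q] from the
     constant term of [p]. *)
  have E1 : pencil x (fun k => Y k + 1 *: D k) = companion n (map_poly polyC p - q%:P).
    rewrite /pencil !big_ord_recl big1 => [|k _]; last first.
      by rewrite /D /= scale1r addrC subrK raddf0 scaler0.
    rewrite /D /x /= scaler0 !addr0 expr0 !scale1r expr1.
    rewrite [Y _ + _]addrC subrK Y0.
    apply/matrixP => i j; rewrite !mxE coefB coef_map coefC /= .
    rewrite -[i == ord_max]/(i == n :> nat) -[j == ord0]/(j == 0%N :> nat).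
    by case: (i == n :> nat); case: (j == 0%N :> nat);
      rewrite /= ?mulr1 ?mulr0 ?addr0 ?subr0 ?polyCN ?opprB ?rmorph_nat // addrC.
  rewrite E1; apply: (@model_coefmx_unit _ _ _ _ r _ (map_poly (horner_eval 1) e)) => //.
  by rewrite -E1 tsE.
apply: (@eclosure_line _ _ _ _ _ D); apply: near0_imp (near0_horner_neq0 Qn0) => s dQ.
have Qu : coefmx x (adjcol (pencil x (fun k => Y k + s *: D k)) (ts s)) \in unitmx.
  by rewrite -evQ unitmxE det_map_mx unitfE.
apply: (eclosure_frakM_curve (t := ts s)) (iffLR (coefmx_unitP _ _) Qu) => i j jL.
by rewrite pencil_adjcol tsE coefN mulrCA coef_Xn_mul_lt ?oppr0.
Qed.

End Path.

(** * Reductions to companion form *)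

Section Reductions.
Variables (R : rcfType) (n l : nat).
Implicit Types (Y : tensor R n.+2 l.+2) (p : {poly R}) (r : R).

(** At a multiple root, adding [e *: ('X - r%:P)] keeps the root and gives it derivative [e]; as [p]
    has degree at least 2, it stays monic. *)
Lemma eclosure_frakM_companion_root Y p r :
  p \is monic -> size p = n.+3 -> Y ord0 = companion n.+1 p -> p.[r] = 0 ->
  eclosure (@frakM R n.+2 l.+2) Y.
Proof.
move=> pm sp Y0 pr; have [dpr|] := eqVneq (p^`().[r]) 0; last first.
  exact: eclosure_frakM_companion pm sp Y0 pr.
pose D : tensor R n.+2 l.+2 := fun k => if k == ord0 then
  \matrix_(i, j) (if i == n.+1 :> nat then - ('X - r%:P)`_j else 0) else 0.
apply: (@eclosure_line _ _ _ _ _ D); apply: near0_imp (near0_pos R) => e e0.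
have sX : (size (e *: ('X - r%:P)) < size p)%N.
  by rewrite sp (leq_ltn_trans (size_scale_leq _ _)) // size_XsubC.
apply: (@eclosure_frakM_companion _ _ _ _ (p + e *: ('X - r%:P)) r).
- by rewrite monicE lead_coefDl // (monicP pm).
- by rewrite size_polyDl.
- rewrite /D eqxx Y0; apply/matrixP => i j; rewrite !mxE.
  by case: ifP => _; rewrite ?mulr0 ?addr0 // [in RHS]coefD coefZ mulrN opprD.
- by rewrite hornerD pr hornerZ hornerXsubC subrr mulr0 addr0.
by rewrite derivD derivZ derivXsubC hornerD dpr hornerZ hornerC mulr1 add0r gt_eqF.
Qed.

End Reductions.

(** Its rows are the iterates of the first unit row vector under [M]; it is invertible exactly when
    that vector is cyclic. *)
Definition krylov (A : comNzRingType) (n : nat) (M : 'M[A]_n.+1) : 'M[A]_n.+1 :=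
  \matrix_(i, j) (M ^+ i) 0 j.

Lemma map_krylov (A B : comNzRingType) (f : {rmorphism A -> B}) (n : nat) (M : 'M[A]_n.+1) :
  map_mx f (krylov M) = krylov (map_mx f M).
Proof. by apply/matrixP => i j; rewrite !mxE -(rmorphXn (map_mx f)) mxE. Qed.

(** The companion matrix of a pure power moves each unit row vector to the next. This matrix
    witnesses that the Krylov determinant is not identically zero. *)
Lemma krylov_shift (A : comNzRingType) (n : nat) : krylov (companion n ('X^(n.+1) : {poly A})) = 1%:M.
Proof.
apply/matrixP => i j; rewrite !mxE.
case: i => i /=; elim: i j => [|i IH] j iN; first by rewrite expr0 mxE.
have iN' : (i < n.+1)%N by apply: ltnW.
rewrite exprSr mxE (bigD1 (Ordinal iN')) //= big1 => [|k kn]; last first.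
  rewrite (IH k iN') -[Ordinal iN' == k]/(i == k :> nat); case: eqP => [ik|_]; rewrite ?mul0r //.
  by case/eqP: kn; apply: val_inj.
by rewrite addr0 (IH _ iN') eqxx mul1r mxE /= ltn_eqF.
Qed.

(** Multiplication by [M] sends each Krylov row to the next, so all rows but the last of the
    conjugate are unit vectors; the last row provides [p]. *)
Lemma krylov_conj (F : fieldType) (n : nat) (M : 'M[F]_n.+1) :
  krylov M \in unitmx ->
  exists p : {poly F}, [/\ p \is monic, size p = n.+2 &
    krylov M *m M *m invmx (krylov M) = companion n p].
Proof.
move=> Ku; set C := krylov M *m M *m invmx (krylov M).
pose c := \poly_(j < n.+1) - C ord_max (inord j).
have sc : (size c < size ('X^(n.+1) : {poly F}))%N by rewrite size_polyXn ltnS size_poly.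
exists ('X^(n.+1) + c); split.
- by rewrite monicE lead_coefDl // lead_coefXn.
- by rewrite size_polyDl // size_polyXn.
apply/matrixP => i j; rewrite [RHS]mxE.
case: ifPn => [/eqP iN|iN].
  rewrite coefD coefXn ltn_eqF // add0r coef_poly ltn_ord inord_val opprK.
  by congr (C _ _); apply: val_inj.
have iN' : (i.+1 < n.+1)%N by rewrite ltnS ltn_neqAle iN /= -ltnS.
have -> : C i j = (1%:M : 'M_n.+1) (Ordinal iN') j; last by rewrite mxE.
rewrite -(mulmxV Ku) /C !mxE; apply: eq_bigr => k _; congr (_ * _).
rewrite !mxE /= exprSr [RHS]mxE; apply: eq_bigr => k' _; by rewrite !mxE.
Qed.

Lemma monic_horner_ge (R : realFieldType) (p : {poly R}) :
  p \is monic -> exists b, forall x, b <= x -> 1 <= p.[x].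
Proof.
elim/poly_ind: p => [|q c IH]; first by rewrite monicE lead_coef0 eq_sym oner_eq0.
have [->|q0] := eqVneq q 0.
  rewrite mul0r add0r monicE lead_coefC => /eqP->; exists 0 => x _; by rewrite hornerC.
have lq : lead_coef (q * 'X + c%:P) = lead_coef q.
  rewrite lead_coefDl ?lead_coefMX // size_mulX // (leq_ltn_trans (size_polyC_leq1 _)) //.
  by rewrite ltnS size_poly_gt0.
rewrite monicE lq => qm; have [b bq] := IH qm.
(* For such [x], [q.[x] * x + c >= x + c >= 1]. *)
exists (Num.max b (Num.max 0 (1 - c))) => x; rewrite !ge_max => /and3P[/bq q1 x0 xc].
rewrite hornerMXaddC; have := ler_wpM2r x0 q1; lra.
Qed.

(** The characteristic polynomial of [t%:M - M] is negative at 0, whatever the parity of [n], and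
    positive far to the right; a root [s] in between gives the eigenvalue [t - s] of [M]. *)
Lemma det_neg_eigenvalue (R : rcfType) (n : nat) (M : 'M[R]_n) (t : R) :
  \det (M - t%:M) < 0 -> exists r, \det (r%:M - M) = 0.
Proof.
move=> dneg; pose p := char_poly (t%:M - M).
have p0 : p.[0] < 0 by rewrite horner_char_poly raddf0 sub0r opprB.
have [b bp] := monic_horner_ge (char_poly_monic (t%:M - M)).
pose b' := Num.max b 0.
have pb : 0 <= p.[b'] by rewrite (le_trans ler01) // bp // le_max lexx.
have b0 : 0 <= b' by rewrite le_max lexx orbT.
have pb0 : p.[0] <= 0 <= p.[b'] by rewrite pb (ltW p0).
have [s _ /rootP] := poly_ivt b0 pb0.
rewrite horner_char_poly => ps; exists (t - s).
have -> : (t - s)%:M - M = -1 *: (s%:M - (t%:M - M)).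
  by rewrite scaleN1r opprB raddfB /= addrAC.
by rewrite detZ ps mulr0.
Qed.

Lemma horner_det_line (R : comNzRingType) (n : nat) (M D : 'M[R]_n) e :
  (\det (map_mx polyC M + 'X *: map_mx polyC D)).[e] = \det (M + e *: D).
Proof.
rewrite -[LHS]/(horner_eval e _) -det_map_mx; congr (\det _).
by apply/matrixP => i j; rewrite !mxE /= /horner_eval hornerD hornerM hornerX !hornerC.
Qed.

Lemma near0_det_lt0 (R : rcfType) (n : nat) (M D : 'M[R]_n) :
  \det M < 0 -> near0 (fun e => \det (M + e *: D) < 0).
Proof.
move=> dM; have : 0 < (- \det (map_mx polyC M + 'X *: map_mx polyC D)).[0].
  by rewrite hornerN horner_det_line scale0r addr0 oppr_gt0.
move=> /near0_horner_gt0; apply: near0_imp => e.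
by rewrite hornerN horner_det_line oppr_gt0.
Qed.

(** * Approximating tensors of [frakC] by tensors of [frakM] *)

Section Approximation.
Variables (R : rcfType) (n l : nat).
Implicit Types (Y : tensor R n.+2 l.+2).

(** A small move of slice 0 towards the shift makes its Krylov matrix invertible while the
    determinant stays negative, so the slice is conjugate to a companion matrix with a real
    eigenvalue. *)
Lemma eclosure_frakM_det_neg Y t :
  \det (Y ord0 - t%:M) < 0 -> eclosure (@frakM R n.+2 l.+2) Y.
Proof.
move=> dneg; pose K := companion n.+1 ('X^(n.+2) : {poly R}).
pose D : tensor R n.+2 l.+2 := fun k => if k == ord0 then K - Y ord0 else 0.
pose q := \det (krylov (map_mx polyC (Y ord0) + 'X *: map_mx polyC (K - Y ord0))).
have qE e : q.[e] = \det (krylov (Y ord0 + e *: (K - Y ord0))).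
  rewrite -[LHS]/(horner_eval e _) -det_map_mx map_krylov; congr (\det (krylov _)).
  by apply/matrixP => i j; rewrite !mxE /= /horner_eval hornerD hornerM hornerX !hornerC.
have q0 : q != 0.
  suff: q.[1] != 0 by apply: contraNneq => ->; rewrite horner0.
  by rewrite qE scale1r addrC subrK krylov_shift det1 oner_eq0.
apply: (@eclosure_line _ _ _ _ _ D).
apply: near0_imp (near0_and (near0_horner_neq0 q0) (near0_det_lt0 (K - Y ord0) dneg)) => e [].
rewrite qE addrAC => Ku /det_neg_eigenvalue[r rE].
rewrite -unitfE -unitmxE in Ku; set M := Y ord0 + _ in Ku rE.
have [p [pm sp CE]] := krylov_conj Ku.
apply: (eclosure_frakM_conj Ku); apply: (eclosure_frakM_companion_root (r := r) pm sp).
  by rewrite /D eqxx.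
rewrite -[p](char_poly_companion pm sp) horner_char_poly -CE.
have -> : r%:M - krylov M *m M *m invmx (krylov M)
        = krylov M *m (r%:M - M) *m invmx (krylov M).
  by rewrite mulmxBr mulmxBl mul_mx_scalar -scalemxAl mulmxV // scalemx1.
by rewrite !det_mulmx rE mulr0 mul0r.
Qed.

Lemma frakC_sub_eclosure_frakM Y : frakC Y -> eclosure (@frakM R n.+2 l.+2) Y.
Proof.
move=> [a0 [t dneg0]].
have [a [an0 dneg]] : exists a : 'rV[R]_l.+2, a != 0 /\ \det (\sum_k a 0 k *: Y k - t%:M) < 0.
  (* If [a0] is zero, a small constant vector keeps the determinant negative. *)
  have [a00|an0] := eqVneq (\row_k a0 k) 0; last first.
    exists (\row_k a0 k); split=> //; rewrite (eq_bigr (fun k => a0 k *: Y k)) // => k _.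
    by rewrite mxE.
  have [e [e0 de]] := near0_ex (near0_and (near0_pos R) (near0_det_lt0 (\sum_k Y k) dneg0)).
  exists (const_mx e); split.
    by apply/eqP => /rowP/(_ 0)/eqP; rewrite !mxE gt_eqF.
  move: de; rewrite /Mmat [X in X - _]big1 => [|k _].
    rewrite sub0r scaler_sumr addrC; congr (\det (_ - _) < 0).
    by apply: eq_bigr => k _; rewrite mxE.
  by move/rowP/(_ k): a00; rewrite !mxE => ->; rewrite scale0r.
(* Mixing by a matrix with first row [a] makes the combination of negative determinant the new slice
   0. *)
have [E Eu rE] := unitmx_row0 an0.
apply: (eclosure_frakM_mix Eu); apply: (@eclosure_frakM_det_neg _ t).
suff -> : \sum_i E ord0 i *: Y i = \sum_k a 0 k *: Y k by [].
by apply: eq_bigr => k _; rewrite -rE mxE.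
Qed.

End Approximation.

Unset Implicit Arguments.

(* l = m - 1 = m.-1 and p = (m-1) n = m.-1 * n (built into frakM). *)
Theorem mainTheorem20 (R : rcfType) (m n : nat) (hm : (3 <= m)%N) (hmn : (m <= n)%N) :
  (forall Y : tensor R n m.-1,
      eclosure (@frakS R n m.-1) Y <-> eclosure (@frakM R n m.-1) Y) /\
  (forall Y : tensor R n m.-1,
      eclosure (@frakM R n m.-1) Y <-> eclosure (@frakC R n m.-1) Y).
Proof.
have n2 := leq_trans hm hmn; case: m hm {hmn} => [|[|[|l]]] // _.
case: n n2 => [|[|n]] // _ /=.
(* The three inclusions form a cycle, so all three closures coincide. *)
have MS Y : frakM Y -> eclosure (@frakS R n.+2 l.+2) Y.
  by move=> MY; apply/eclosure_mem/frakM_sub_frakS.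
have CM Y : frakC Y -> eclosure (@frakM R n.+2 l.+2) Y.
  exact: frakC_sub_eclosure_frakM.
have SC Y : frakS Y -> eclosure (@frakC R n.+2 l.+2) Y.
  exact: frakS_sub_eclosure_frakC.
split=> Y; split.
- by move=> /(eclosure_sub SC)/(eclosure_sub CM).
- exact: eclosure_sub MS.
- by move=> /(eclosure_sub MS)/(eclosure_sub SC).
- exact: eclosure_sub CM.
Qed.
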